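(* Let $\mathcal{A}$ be a Banach algebra. (i) Suppose $(\mathcal{A}^{**},\square)$ is approximately cyclic amenable and every cyclic derivation $D:\mathcal{A}\to\mathcal{A}^{*}$ satisfies $D^{**}(\mathcal{A}^{**})\subseteq WAP(\mathcal{A})$. Then $\mathcal{A}$ is approximately cyclic amenable. (ii) Suppose $\mathcal{A}$ is Arens regular, every derivation $D:\mathcal{A}\to\mathcal{A}^{*}$ is weakly compact, and $\mathcal{A}^{**}$ is approximately cyclic amenable. Then $\mathcal{A}$ is approximately cyclic amenable.
   Context: Banach algebras are over $\mathbb{C}$ and need not be unital. For a Banach algebra $\mathcal{A}$, the dual $\mathcal{A}^{*}$ is a Banach $\mathcal{A}$-bimodule via $\langle a\cdot x^{*},x\rangle=\langle x^{*},xa\rangle$ and $\langle x^{*}\cdot a,x\rangle=\langle x^{*},ax\rangle$ for $a,x\in\mathcal{A}$, $x^*\in\mathcal{A}^*$. A derivation $D:\mathcal{A}\to\mathcal{A}^{*}$ is a bounded linear map with $D(ab)=D(a)\cdot b+a\cdot D(b)$ for all $a,b\in\mathcal{A}$. It is cyclic if $\langle D(a),b\rangle+\langle D(b),a\rangle=0$ for all $a,b\in\mathcal{A}$. It is approximately inner if there is a net $(x_\alpha)\subseteq\mathcal{A}^{*}$ (not required to be bounded) with $D(a)=\lim_\alpha(a\cdot x_\alpha-x_\alpha\cdot a)$ in norm for every $a\in\mathcal{A}$. $\mathcal{A}$ is approximately cyclic amenable if every cyclic derivation $D:\mathcal{A}\to\mathcal{A}^{*}$ is approximately inner. The first and second Arens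 products $\square$ and $\lozenge$ on $\mathcal{A}^{**}$ are defined, for $a,b\in\mathcal{A}$, $a^*\in\mathcal{A}^*$, $a^{**},b^{**}\in\mathcal{A}^{**}$, by $\langle a^{*}\cdot a,b\rangle=\langle a^{*},ab\rangle$, $\langle a\cdot a^{*},b\rangle=\langle a^{*},ba\rangle$; $\langle a^{**}\cdot a^{*},a\rangle=\langle a^{**},a^{*}\cdot a\rangle$, $\langle a^{*}\cdot a^{**},b\rangle=\langle a^{**},b\cdot a^{*}\rangle$; $\langle a^{**}\square b^{**},a^{*}\rangle=\langle a^{**},b^{**}\cdot a^{*}\rangle$, $\langle a^{**}\lozenge b^{**},a^{*}\rangle=\langle b^{**},a^{*}\cdot a^{**}\rangle$. Each makes $\mathcal{A}^{**}$ a Banach algebra. $\mathcal{A}$ is Arens regular if the two products coincide on $\mathcal{A}^{**}$ (in which case $\mathcal{A}^{**}$ carries this common product). $WAP(\mathcal{A})=\{a^{*}\in\mathcal{A}^{*}: \text{the map } \mathcal{A}\to\mathcal{A}^{*},\ a\mapsto a\cdot a^{*},\text{ is weakly compact}\}$. $D^{**}:\mathcal{A}^{**}\to\mathcal{A}^{***}$ is the second adjoint of $D$, and $\mathcal{A}^{*}$ (hence $WAP(\mathcal{A})$) is regarded as a subspace of $\mathcal{A}^{***}$ via the canonical embedding. *)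

(* Defs.v *)
From HB Require Import structures.
From mathcomp Require Import all_boot all_order all_algebra.
From mathcomp Require Import all_classical all_reals all_analysis.
From mathcomp.real_closed Require Import complex.

Set Implicit Arguments.
Unset Strict Implicit.
Unset Printing Implicit Defensive.

Import Order.TTheory GRing.Theory Num.Theory.
Import numFieldNormedType.Exports.

Local Open Scope classical_set_scope.
Local Open Scope ring_scope.

Section ComplexComplete.
Variable R : realType.

Lemma normC_le_ReIm (z : R[i]) : `|z| <= (`|complex.Re z| + `|complex.Im z|)%:C%C.
Proof.
rewrite [X in `|X|]complexE (le_trans (ler_normD _ _))// normrM.
have -> : `|'i%C : R[i]| = 1 by rewrite normc_def /= expr0n /= add0r expr1n sqrtr1.
by rewrite mul1r !normc_def /= expr0n /= !addr0 !sqrtr_sqr -rmorphD.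
Qed.

Lemma Re_norm_le (z : R[i]) : `|complex.Re z|%:C%C <= `|z|.
Proof.
rewrite normc_def lecR -sqrtr_sqr ler_wsqrtr// lerDl sqr_ge0 //.
Qed.

Lemma Im_norm_le (z : R[i]) : `|complex.Im z|%:C%C <= `|z|.
Proof.
rewrite normc_def lecR -sqrtr_sqr ler_wsqrtr// lerDr sqr_ge0 //.
Qed.

Lemma complex_complete (F : set_system R[i]^o) :
  ProperFilter F -> cauchy F -> cvg F.
Proof.
move=> FF Fc.
have cauchy_part (p : R[i]^o -> R) :
    (forall x y, `|p x - p y|%:C%C <= `|x - y|) -> cvg (p @ F).
  move=> pl; apply: cauchy_cvg; apply: cauchy_exP => e e0.
  have /cauchyP /(_ e%:C%C) := Fc; rewrite ltcR => /(_ e0)[x Fx]; exists (p x).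
  apply: (@filterS _ F _ (ball x e%:C%C) (p @^-1` ball (p x) e)) Fx => y.
  rewrite -!ball_normE /= => xy.
  by rewrite -ltcR; exact: le_lt_trans (pl _ _) xy.
have /cvgrPdist_lt ReF : cvg ((@complex.Re R : R[i]^o -> R) @ F).
  by apply: cauchy_part => x y; rewrite -raddfB; exact: Re_norm_le.
have /cvgrPdist_lt ImF : cvg ((@complex.Im R : R[i]^o -> R) @ F).
  by apply: cauchy_part => x y; rewrite -raddfB; exact: Im_norm_le.
set a := lim _ in ReF; set b := lim _ in ImF.
apply/cvg_ex; exists (Complex a b : R[i]^o).
apply/(@cvgrPdist_lt _ _ _ F _ id) => e e0.
have [/eqP ie re0] : complex.Im e == 0 /\ 0 < complex.Re e.
  by move: e0; rewrite ltcE /= => /andP[].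
have eE : e = (complex.Re e)%:C%C by rewrite [LHS]complexE ie mulr0 addr0.
have e20 : 0 < complex.Re e / 2 by rewrite divr_gt0.
near=> z.
rewrite (le_lt_trans (normC_le_ReIm _))// eE ltcR [ltRHS]splitr !raddfB /=.
by apply: ltrD; near: z; [exact: ReF|exact: ImF].
Unshelve. all: by end_near. Qed.


HB.instance Definition _ := NormedModule.copy R[i] R[i]^o.
HB.instance Definition _ := Uniform_isComplete.Build R[i] complex_complete.

End ComplexComplete.

(* Norms over [R[i]] take their values in [R[i]], hence the coercion of the
   real supremum in [opnorm] below. *)
Section BoundedLinear.
Variables (R : realType) (V W : normedModType R[i]).

Definition bounded_linear_pred : {pred V -> W} :=
  fun f => `[< linear f /\ exists M : R[i], forall x, `|f x| <= M * `|x| >].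

Record blin := BLin {
  blin_fun :> V -> W;
  blin_funP : blin_fun \in bounded_linear_pred }.

HB.instance Definition _ := [isSub for blin_fun].
HB.instance Definition _ := gen_eqMixin blin.
HB.instance Definition _ := gen_choiceMixin blin.

Lemma bounded_linear_submod : submod_closed bounded_linear_pred.
Proof.
split=> [|a f g /asboolP[lf [M fM]] /asboolP[lg [N gN]]]; apply/asboolP; split.
- by move=> k x y; rewrite /= scaler0 addr0.
- by exists 0 => x; rewrite normr0 mul0r.
- move=> k x y; rewrite /= !fctE lf lg !scalerDr addrACA; congr (_ + _ + _ ).
  by rewrite !scalerA mulrC.
- exists (`|a| * M + N) => x; rewrite (le_trans (ler_normD _ _))// mulrDl.
  by rewrite lerD// normrZ -mulrA ler_wpM2l.
Qed.

HB.instance Definition _ :=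
  GRing.isSubmodClosed.Build R[i] (V -> W) bounded_linear_pred
    bounded_linear_submod.
HB.instance Definition _ := [SubChoice_isSubLmodule of blin by <:].

Implicit Types f g : blin.

Lemma blin_linear f : linear f.
Proof. by have /asboolP[] := blin_funP f. Qed.

Lemma blin_bounded f : exists M : R[i], forall x, `|f x| <= M * `|x|.
Proof. by have /asboolP[] := blin_funP f. Qed.

Lemma blinP f g : f =1 g -> f = g.
Proof. by move=> fg; apply: val_inj; apply: funext. Qed.

HB.instance Definition _ f := GRing.isLinear.Build R[i] V W _ f (blin_linear f).

Lemma blinDE f g x : (f + g) x = f x + g x. Proof. by []. Qed.
Lemma blinZE (a : R[i]) f x : (a *: f) x = a *: f x. Proof. by []. Qed.
Lemma blinNE f x : (- f) x = - f x. Proof. by []. Qed.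
Lemma blin0E x : (0 : blin) x = 0. Proof. by []. Qed.

Definition opnorm f : R[i] :=
  (sup [set complex.Re `|f x| | x in [set x | `|x| <= 1]])%:C%C.

Lemma ReK (z : R[i]) : 0 <= z -> (complex.Re z)%:C%C = z.
Proof. by move=> z0; rewrite RRe_real// ger0_real. Qed.

Let has_sup_opnorm f :
  has_sup [set complex.Re `|f x| | x in [set x | `|x| <= 1]].
Proof.
split; first by exists (complex.Re `|f 0|); exists 0 => //=; rewrite normr0.
have [M fM] := blin_bounded f.
have [m m0 Mm] : exists2 m : R[i], 0 <= m & forall x, `|f x| <= m * `|x|.
  exists `|M| => [|x]; first exact: normr_ge0.
  rewrite -[`|x|]normr_id -normrM (le_trans (fM x))// real_ler_norm//.
  by rewrite (ger0_real (le_trans _ (fM x))).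
exists (complex.Re m) => _ [x /= x1 <-].
by rewrite -lecR !ReK// (le_trans (Mm x))// ler_piMr.
Qed.

Lemma opnorm_ge0 f : 0 <= opnorm f.
Proof.
rewrite /opnorm ler0c; apply: le_trans (_ : complex.Re `|f 0| <= _).
  by rewrite -ler0c ReK.
by apply: sup_upper_bound => //; exists 0 => //=; rewrite normr0.
Qed.

Lemma le_opnorm f x : `|f x| <= opnorm f * `|x|.
Proof.
have [->|x0] := eqVneq x 0; first by rewrite linear0 !normr0 mulr0.
rewrite -ler_pdivrMr ?normr_gt0// mulrC.
have -> : `|x|^-1 * `|f x| = `|f (`|x|^-1 *: x)|.
  by rewrite linearZ normrZ normfV normr_id.
rewrite /opnorm -[leLHS]ReK ?normr_ge0// lecR; apply: sup_upper_bound => //; exists (`|x|^-1 *: x) => //=.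
by rewrite normrZ normfV normr_id mulVf// normr_eq0.
Qed.

Lemma opnorm_le f (M : R[i]) :
  0 <= M -> (forall x, `|f x| <= M * `|x|) -> opnorm f <= M.
Proof.
move=> M0 fM; rewrite -(ReK M0) lecR.
apply: ge_sup; first by case: (has_sup_opnorm f).
move=> _ [x /= x1 <-]; rewrite -lecR !ReK//.
by rewrite (le_trans (fM x))// ler_piMr.
Qed.

Lemma opnormD f g : opnorm (f + g) <= opnorm f + opnorm g.
Proof.
apply: opnorm_le => [|x]; first by rewrite addr_ge0 ?opnorm_ge0.
by rewrite (le_trans (ler_normD _ _))// mulrDl lerD// le_opnorm.
Qed.

Lemma opnormZ (l : R[i]) f : opnorm (l *: f) = `|l| * opnorm f.
Proof.
have le k h : opnorm (k *: h) <= `|k| * opnorm h.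
  apply: opnorm_le => [|x]; first by rewrite mulr_ge0 ?opnorm_ge0.
  by rewrite blinZE normrZ -mulrA ler_wpM2l// le_opnorm.
apply/eqP; rewrite eq_le le /=; have [->|l0] := eqVneq l 0.
  by rewrite normr0 mul0r opnorm_ge0.
rewrite -ler_pdivlMl ?normr_gt0// -normfV.
by rewrite -[X in opnorm X <= _](scalerK l0) le.
Qed.

Lemma opnorm0_eq0 f : opnorm f = 0 -> f = 0.
Proof.
move=> f0; apply: blinP => x; apply/eqP; rewrite -normr_le0.
by rewrite (le_trans (le_opnorm f x))// f0 mul0r.
Qed.

HB.instance Definition _ :=
  Lmodule_isNormed.Build R[i] blin opnormD opnormZ opnorm0_eq0.

Lemma le_blin_norm f x : `|f x| <= `|f| * `|x|.
Proof. exact: le_opnorm. Qed.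

Lemma blin_norm_le f (M : R[i]) :
  0 <= M -> (forall x, `|f x| <= M * `|x|) -> `|f| <= M.
Proof. exact: opnorm_le. Qed.

Lemma bounded_linear_predP (h : V -> W) (M : R[i]) :
  linear h -> (forall x, `|h x| <= M * `|x|) -> h \in bounded_linear_pred.
Proof. by move=> lh hM; apply/asboolP; split=> //; exists M. Qed.

Definition mkblin (h : V -> W) (M : R[i]) (lh : linear h)
    (hM : forall x, `|h x| <= M * `|x|) : blin :=
  BLin (bounded_linear_predP lh hM).

End BoundedLinear.

Section BlinComplete.
Variables (R : realType) (V : normedModType R[i]).
Variable W : completeNormedModType R[i].

Lemma blin_complete (F : set_system (blin V W)) :
  ProperFilter F -> cauchy F -> cvg F.
Proof.
move=> FF /cauchyP Fc.
have Fclose (e : R[i]) : 0 < e ->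
    exists g : blin V W, \forall f \near F, `|g - f| < e.
  move=> e0; have [g Fg] := Fc e e0; exists g.
  by apply: filterS Fg => f; rewrite -ball_normE.
have cvgx x : cvg ((fun f : blin V W => f x) @ F).
  apply: cauchy_cvg; apply: cauchy_exP => e e0.
  have x1 : 0 < `|x| + 1 by rewrite ltr_wpDl ?ltr01 ?normr_ge0.
  have [g Fg] := Fclose _ (divr_gt0 e0 x1); exists (g x).
  apply: (@filterS _ F _ (fun f : blin V W => `|g - f| < e / (`|x| + 1))) Fg => f.
  move=> gf; rewrite /= -ball_normE /= -blinNE -blinDE.
  rewrite (le_lt_trans (le_blin_norm _ _))//.
  rewrite (le_lt_trans (ler_wpM2r _ (ltW gf)))// mulrAC ltr_pdivrMr//.
  by rewrite ltr_pM2l// ltrDl.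
pose h x := lim ((fun f : blin V W => f x) @ F).
have hE x : (fun f : blin V W => f x) @ F --> h x by exact: cvgx.
have hl : linear h.
  move=> a x y; apply: cvg_lim => //.
  rewrite (_ : (fun f : blin V W => f _) = fun f : blin V W => a *: f x + f y).
    by apply: cvgD => //; apply: cvgZl_tmp.
  by apply: funext => f; rewrite linearP.
have hle (g : blin V W) (e : R[i]) x : (\forall f \near F, `|g - f| < e) ->
    `|g x - h x| <= e * `|x|.
  move=> Fg; apply/ler_addgt0Pr => d d0.
  near F => f.
  have -> : g x - h x = (g - f) x + (f x - h x) by rewrite blinDE blinNE addrA subrK.
  rewrite (le_trans (ler_normD _ _))// lerD//.
    rewrite (le_trans (le_blin_norm _ _))// ler_wpM2r// ltW//.
    by near: f.
  rewrite distrC; near: f; move/cvgrPdist_le : (hE x); exact.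
have [g0 Fg0] := Fclose 1 ltr01.
have hM x : `|h x| <= (`|g0| + 1) * `|x|.
  rewrite -[h x](subKr (g0 x)) (le_trans (ler_normB _ _))// mulrDl lerD//.
    exact: le_blin_norm.
  exact: hle.
apply/cvg_ex; exists (mkblin hl hM).
apply/(@cvgrPdist_le _ _ _ F _ id) => e e0.
have e2 : 0 < e / 2 by rewrite divr_gt0.
have [g Fg] := Fclose _ e2; have hg y := hle _ _ y Fg.
apply: (@filterS _ F _ (fun f : blin V W => `|g - f| < e / 2)) Fg => f gf.
apply: blin_norm_le => [|x]; first exact: ltW.
have -> : (mkblin hl hM - f) x = (h x - g x) + (g - f) x.
  by rewrite !blinDE !blinNE addrA subrK.
rewrite (le_trans (ler_normD _ _))// [e]splitr mulrDl lerD//.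
  by rewrite distrC.
by rewrite (le_trans (le_blin_norm _ _))// ler_wpM2r// ltW.
Unshelve. all: by end_near. Qed.

HB.instance Definition _ := Uniform_isComplete.Build (blin V W) blin_complete.
End BlinComplete.

Definition dual (R : realType) (V : normedModType R[i]) :
  completeNormedModType R[i] := blin V R[i].

Section Duality.
Variable R : realType.
Implicit Types V W : normedModType R[i].

Lemma canonical_embedding_linear V (x : V) : linear (fun f : dual V => f x).
Proof. by move=> k f g; rewrite blinDE blinZE. Qed.

Lemma canonical_embedding_bound V (x : V) (f : dual V) :
  `|f x| <= `|x| * `|f|.
Proof. by rewrite mulrC; exact: le_blin_norm. Qed.

Definition canonical_embedding V (x : V) : dual (dual V) :=
  mkblin (canonical_embedding_linear x) (canonical_embedding_bound x).

Section Adjoint.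
Variables (V W : normedModType R[i]) (T : blin V W).

Lemma adjoint_fun_linear (g : dual W) : linear (fun x => g (T x)).
Proof. by move=> k x y; rewrite !linearP. Qed.

Lemma adjoint_fun_bound (g : dual W) x : `|g (T x)| <= `|T| * `|g| * `|x|.
Proof.
rewrite (le_trans (le_blin_norm _ _))// [`|T| * _]mulrC -mulrA ler_wpM2l//.
exact: le_blin_norm.
Qed.

Definition adjoint_fun (g : dual W) : dual V :=
  mkblin (adjoint_fun_linear g) (adjoint_fun_bound g).

Lemma adjoint_linear : linear adjoint_fun.
Proof. by move=> k f g; apply: blinP => x; rewrite !blinDE !blinZE. Qed.

Lemma adjoint_bound (g : dual W) : `|adjoint_fun g| <= `|T| * `|g|.
Proof.
by apply: blin_norm_le; [rewrite mulr_ge0|exact: adjoint_fun_bound].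
Qed.

Definition adjoint : blin (dual W) (dual V) :=
  mkblin adjoint_linear adjoint_bound.

End Adjoint.

Definition weak V :=
  initial_topology
    (fun v : V => (fun f : dual V => f v) : {ptws dual V -> R[i]}).

Definition weakly_compact V W (T : V -> W) :=
  precompact ((T @` [set x | `|x| <= 1]) : set (weak W)).

End Duality.

(* No unit is required. *)
Record banachAlgebra (R : realType) := BanachAlgebra {
  ba_space :> completeNormedModType R[i];
  ba_mul : ba_space -> ba_space -> ba_space;
  ba_mulA : associative ba_mul;
  ba_mul_linearl : forall b, linear (ba_mul ^~ b);
  ba_mul_linearr : forall a, linear (ba_mul a);
  ba_norm_mul : forall a b, `|ba_mul a b| <= `|a| * `|b| }.

Section DualModule.
Variables (R : realType) (A : banachAlgebra R).
Implicit Types (a b : A) (f g : dual A).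

Lemma actl_subproof_linear a f : linear (fun x => f (ba_mul x a)).
Proof. by move=> k x y; rewrite ba_mul_linearl linearP. Qed.

Lemma actl_subproof_bound a f x : `|f (ba_mul x a)| <= `|f| * `|a| * `|x|.
Proof.
rewrite (le_trans (le_blin_norm _ _))// -mulrA ler_wpM2l// mulrC.
exact: ba_norm_mul.
Qed.

(* [actl a f] is a . f and [actr f a] is f . a *)
Definition actl a f : dual A :=
  mkblin (actl_subproof_linear a f) (actl_subproof_bound a f).

Lemma actr_subproof_linear f a : linear (fun x => f (ba_mul a x)).
Proof. by move=> k x y; rewrite ba_mul_linearr linearP. Qed.

Lemma actr_subproof_bound f a x : `|f (ba_mul a x)| <= `|f| * `|a| * `|x|.
Proof.
rewrite (le_trans (le_blin_norm _ _))// -mulrA ler_wpM2l//.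
exact: ba_norm_mul.
Qed.

Definition actr f a : dual A :=
  mkblin (actr_subproof_linear f a) (actr_subproof_bound f a).

Lemma actl_linearl f : linear (actl ^~ f).
Proof.
by move=> k a b; apply: blinP => x /=; rewrite ba_mul_linearr linearP.
Qed.

Lemma actl_linearr a : linear (actl a).
Proof. by move=> k f g; apply: blinP => x; rewrite !blinDE !blinZE. Qed.

Lemma actr_linearl a : linear (actr ^~ a).
Proof. by move=> k f g; apply: blinP => x; rewrite !blinDE !blinZE. Qed.

Lemma actr_linearr f : linear (actr f).
Proof.
by move=> k a b; apply: blinP => x /=; rewrite ba_mul_linearl linearP.
Qed.

Lemma norm_actl a f : `|actl a f| <= `|f| * `|a|.
Proof.
by apply: blin_norm_le; [rewrite mulr_ge0|exact: actl_subproof_bound].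
Qed.

Lemma norm_actr f a : `|actr f a| <= `|f| * `|a|.
Proof.
by apply: blin_norm_le; [rewrite mulr_ge0|exact: actr_subproof_bound].
Qed.

End DualModule.

Section Arens.
Variables (R : realType) (A : banachAlgebra R).
Implicit Types (a b : A) (f g : dual A) (p q r : dual (dual A)).

Lemma bactl_subproof_linear p f : linear (fun a => p (actr f a)).
Proof. by move=> k a b; rewrite actr_linearr linearP. Qed.

Lemma bactl_subproof_bound p f a : `|p (actr f a)| <= `|p| * `|f| * `|a|.
Proof.
rewrite (le_trans (le_blin_norm _ _))// -mulrA ler_wpM2l//.
exact: norm_actr.
Qed.

(* [bactl p f] is p . f and [bactr f p] is f . p *)
Definition bactl p f : dual A :=
  mkblin (bactl_subproof_linear p f) (bactl_subproof_bound p f).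

Lemma bactr_subproof_linear f p : linear (fun b => p (actl b f)).
Proof. by move=> k a b; rewrite actl_linearl linearP. Qed.

Lemma bactr_subproof_bound f p b : `|p (actl b f)| <= `|p| * `|f| * `|b|.
Proof.
rewrite (le_trans (le_blin_norm _ _))// -mulrA ler_wpM2l//.
exact: norm_actl.
Qed.

Definition bactr f p : dual A :=
  mkblin (bactr_subproof_linear f p) (bactr_subproof_bound f p).

Lemma bactl_linearl f : linear (bactl ^~ f).
Proof. by move=> k p q; apply: blinP => x; rewrite !blinDE !blinZE. Qed.

Lemma bactl_linearr p : linear (bactl p).
Proof.
by move=> k f g; apply: blinP => a /=; rewrite actr_linearl linearP.
Qed.

Lemma bactr_linearl p : linear (bactr ^~ p).
Proof.
by move=> k f g; apply: blinP => a /=; rewrite actl_linearr linearP.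
Qed.

Lemma norm_bactl p f : `|bactl p f| <= `|p| * `|f|.
Proof.
by apply: blin_norm_le; [rewrite mulr_ge0|exact: bactl_subproof_bound].
Qed.

Lemma norm_bactr f p : `|bactr f p| <= `|p| * `|f|.
Proof.
by apply: blin_norm_le; [rewrite mulr_ge0|exact: bactr_subproof_bound].
Qed.

Lemma arens1_subproof_linear p q : linear (fun f => p (bactl q f)).
Proof. by move=> k f g; rewrite bactl_linearr linearP. Qed.

Lemma arens1_subproof_bound p q f : `|p (bactl q f)| <= `|p| * `|q| * `|f|.
Proof.
rewrite (le_trans (le_blin_norm _ _))// -mulrA ler_wpM2l//.
exact: norm_bactl.
Qed.

Definition arens1 p q : dual (dual A) :=
  mkblin (arens1_subproof_linear p q) (arens1_subproof_bound p q).

Lemma arens2_subproof_linear p q : linear (fun f => q (bactr f p)).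
Proof. by move=> k f g; rewrite bactr_linearl linearP. Qed.

Lemma arens2_subproof_bound p q f : `|q (bactr f p)| <= `|q| * `|p| * `|f|.
Proof.
rewrite (le_trans (le_blin_norm _ _))// -mulrA ler_wpM2l//.
exact: norm_bactr.
Qed.

Definition arens2 p q : dual (dual A) :=
  mkblin (arens2_subproof_linear p q) (arens2_subproof_bound p q).

Lemma arens1A : associative arens1.
Proof.
move=> p q r; apply: blinP => f /=; congr (p _).
apply: blinP => a /=; congr (q _); apply: blinP => b /=; congr (r _).
by apply: blinP => c /=; rewrite ba_mulA.
Qed.

Lemma arens1_linearl q : linear (arens1 ^~ q).
Proof. by move=> k p r; apply: blinP => x; rewrite !blinDE !blinZE. Qed.

Lemma arens1_linearr p : linear (arens1 p).
Proof.
by move=> k q r; apply: blinP => f /=; rewrite bactl_linearl linearP.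
Qed.

Lemma norm_arens1 p q : `|arens1 p q| <= `|p| * `|q|.
Proof.
by apply: blin_norm_le; [rewrite mulr_ge0|exact: arens1_subproof_bound].
Qed.

Definition bidual_algebra : banachAlgebra R :=
  BanachAlgebra arens1A arens1_linearl arens1_linearr norm_arens1.

Definition arens_regular := forall p q, arens1 p q = arens2 p q.

Definition WAP : set (dual A) :=
  [set f | weakly_compact (fun a : A => actl a f)].

End Arens.
Arguments WAP {R} A.

Record directed (I : Type) (le : I -> I -> Prop) : Prop := Directed {
  directed_inhabited : inhabited I;
  directed_refl : forall i, le i i;
  directed_trans : forall i j k, le i j -> le j k -> le i k;
  directed_ub : forall i j, exists k, le i k /\ le j k }.

(* The filter of tails of a directed set: [x i @[i --> tails le] --> l] is
   convergence of the net [x]. *)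
Definition tails (I : Type) (le : I -> I -> Prop) : set_system I :=
  filter_from setT (fun i => [set j | le i j]).

Section Amenability.
Variables (R : realType) (A : banachAlgebra R).
Implicit Type D : blin A (dual A).

Definition derivation D :=
  forall a b, D (ba_mul a b) = actr (D a) b + actl a (D b).

Definition cyclic_derivation D :=
  derivation D /\ forall a b, D a b + D b a = 0.

Definition approximately_inner D :=
  exists (I : Type) (le : I -> I -> Prop) (x : I -> dual A), directed le /\
    forall a, actl a (x i) - actr (x i) a @[i --> tails le] --> D a.

Definition approximately_cyclic_amenable :=
  forall D, cyclic_derivation D -> approximately_inner D.

End Amenability.

(* Main.v *)
Require Import Defs.
From mathcomp Require Import all_boot all_order all_algebra.
From mathcomp Require Import all_classical all_reals all_analysis.
From mathcomp.real_closed Require Import complex.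
From mathcomp Require Import ring lra.

(** The plan is to lift a cyclic derivation [D : A -> A^*] to its second adjoint
[D^** : A^** -> A^***], to approximate [D^**] there by inner derivations, and to
come back. Coming back is free: if the net [X_i] in [A^***] works for [D^**],
then its restriction to [A] along the canonical embedding works for [D], since
restriction is a contraction that intertwines the actions of [A] and extends
[D^**] back to [D] ([approximately_inner_restrict]).

The lift needs care, because [D^**] need not be a derivation for the first
Arens product. Expanding [D^**(p q)] at [r] by iterated limits gives the
expected term [D^**(p) . q], but the other term comes out as the SECOND Arens
product of [r] and [p] evaluated where [p . D^**(q)] asks for the first one.
When [D^**(q)] is an honest functional [f] in [A^*], the discrepancy is exactly
whether the two Arens products of [r] and [p] agree at [f]
([bidual_cyclic_derivation]). In the Arens regular case they always do. In the
other case [f] is weakly almost periodic, and the products agree at such an [f]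
([WAP_arens_agree]).

Two facts are thus wanted, that the second adjoint of a weakly compact
derivation takes its values in [A^*], and that the Arens products agree on
[WAP A]. Both follow from one half of Gantmacher's theorem: the second adjoint
of a weakly compact [T : V -> W] maps [V^**] into [W]
([weakly_compact_bidual]). For the latter fact [T] is [a |-> a . f]: then
[T^**(q)] evaluated at [r] is the second Arens product of [r] and [q] at [f],
and the element of [A^*] that represents [T^**(q)] can only be [q . f], which
yields the first Arens product.

Gantmacher's theorem rests on Goldstine's: finitely many values of a bidual
element of norm at most 1 are approximately those of a vector of the unit ball.
Separation of convex sets is only needed in finite dimension here, and is
replaced by looking at a near minimiser of a sum of squares on the unit ball
([Re_goldstine]). *)

Set Implicit Arguments.
Unset Strict Implicit.
Unset Printing Implicit Defensive.
Import Order.TTheory GRing.Theory Num.Theory.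
Import numFieldNormedType.Exports.

Local Open Scope classical_set_scope.
Local Open Scope ring_scope.

(** * Goldstine's and Gantmacher's theorems *)

Section Goldstine.
Variable R : realType.
Implicit Types V W : normedModType R[i].

Lemma Re_scale (a : R) (z : R[i]) : complex.Re (a%:C%C * z) = a * complex.Re z.
Proof. by case: z => x y /=; rewrite mul0r subr0. Qed.

Lemma Re_le_norm (z : R[i]) (c : R) : `|z| <= c%:C%C -> complex.Re z <= c.
Proof.
move=> zc; rewrite -lecR; apply: le_trans zc; apply: le_trans (Re_norm_le _).
by rewrite lecR ler_norm.
Qed.

(** Rotating [y] by the phase of [f y] makes [f y] real and nonnegative. *)
Lemma norm_le_of_Re_le V (f : dual V) (c : R) :
  (forall y, `|y| <= 1 -> complex.Re (f y) <= c) -> `|f| <= c%:C%C.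
Proof.
move=> fc.
have c0 : 0 <= c by have := fc 0; rewrite linear0 normr0 ler01; exact.
apply: blin_norm_le => [|y]; first by rewrite ler0c.
have [fy0|fy0] := eqVneq (f y) 0.
  by rewrite fy0 normr0 mulr_ge0 ?ler0c.
have y0 : y != 0 by apply: contra_neq fy0 => ->; rewrite linear0.
have ny0 : `|y| != 0 by rewrite normr_eq0.
rewrite -ler_pdivrMr ?normr_gt0//.
have Efu : f ((`|f y| / f y / `|y|) *: y) = `|f y| / `|y|.
  by rewrite linearZ /= /GRing.scale/= mulrAC mulfVK.
rewrite -[leLHS]ReK ?divr_ge0// lecR -Efu; apply: fc.
by rewrite normrZ !normrM !normfV !normr_id mulfVK// mulfV// normr_eq0.
Qed.

Lemma Re_oscillation_bounded V (s : seq (dual V)) :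
  exists2 M : R, 0 <= M & forall x y, `|x| <= 1 -> `|y| <= 1 ->
    \sum_(f <- s) (complex.Re (f y) - complex.Re (f x)) ^+ 2 <= M.
Proof.
exists (\sum_(f <- s) (2 * complex.Re `|f|) ^+ 2) => [|x y x1 y1].
  by apply: sumr_ge0 => f _; exact: sqr_ge0.
apply: ler_sum => f _; rewrite -[leLHS]real_normK ?num_real//.
have f2 : (2 * complex.Re `|f|)%:C%C = `|f| * 2 :> R[i].
  by rewrite mulrC rmorphM/= -[in RHS](ReK (normr_ge0 f)) rmorph_nat.
have f20 : 0 <= 2 * complex.Re `|f| by rewrite -ler0c f2 mulr_ge0.
rewrite lerXn2r ?nnegrE// -lecR f2 -!raddfB (le_trans (Re_norm_le _))//.
rewrite (le_trans (le_blin_norm _ _))// ler_wpM2l//.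
by rewrite (le_trans (ler_normB _ _))// -[2]/(1 + 1) lerD.
Qed.

(** The step length [t] for a quadratic function bounded below by [m], with value
[v] within [t * t] of [m], slope [2 * S] and second-order coefficient [Q]. That
gap and the second-order term both cost order [t ^+ 2], so dividing by [t]
bounds [- S] by [t * (1 + M) / 2], and [t] makes this at most [m / 2]. *)
Lemma near_min_slope (m M : R) : 0 < m -> 0 <= M ->
  exists t, [/\ 0 < t, t <= 1 & forall v S Q, v < m + t * t -> Q <= M ->
    m <= v + t * 2 * S + t ^+ 2 * Q -> - S <= m / 2].
Proof.
move=> m0 M0; pose t := m / (m + 1 + M).
have mM : 0 < m + 1 + M by lra.
have t0 : 0 < t by rewrite divr_gt0.
have tM : t * (1 + M) <= m.
  by rewrite /t mulrAC ler_pdivrMr// ler_pM2l//; lra.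
have t1 : t <= 1 by rewrite ler_pdivrMr// mul1r; lra.
exists t; split => // v S Q vt QM mv; rewrite -(ler_pM2l t0).
have := ler_wpM2l (ltW t0) tM.
have := ler_wpM2l (mulr_ge0 (ltW t0) (ltW t0)) QM.
by clearbody t; rewrite expr2 in mv; clear -vt mv; lra.
Qed.

(** If the sum of squares [phi] stayed above a positive infimum [m] on the unit
ball, take [x] nearly minimising it. Minimality along the segment from [x] to
any [y] of the ball bounds the directional derivative of [phi] from below, that
is, it bounds [Re (g y) - Re (g x)] from above, where [g] is the combination of
the functionals of [s] with the residuals at [x], negated, as coefficients.
Since [y] is arbitrary this bounds the norm of [g], hence [Re (p g)], as [p] has
norm at most 1. But [Re (p g) - Re (g x)] is [phi x] itself, so [phi x] is at
most [m / 2]. *)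
Lemma Re_goldstine V (p : dual (dual V)) (s : seq (dual V)) (d : R) :
  `|p| <= 1 -> 0 < d ->
  exists2 x, `|x| <= 1 &
    \sum_(f <- s) complex.Re (f x - p f) ^+ 2 < d.
Proof.
move=> p1 d0; pose u (f : dual V) x := complex.Re (f x - p f).
pose phi x := \sum_(f <- s) u f x ^+ 2.
apply: contrapT => nx.
have phid x : `|x| <= 1 -> d <= phi x.
  by move=> x1; rewrite leNgt; apply/negP => px; apply: nx; exists x.
pose E := phi @` [set x | `|x| <= 1].
have lbE : has_lbound E by exists d => _ [x /= x1 <-]; exact: phid.
have hE : has_inf E.
  by split=> //; exists (phi 0), 0 => //=; rewrite normr0 ler01.
set m := inf E.
have mle x : `|x| <= 1 -> m <= phi x.
  by move=> x1; apply: ge_inf => //; exists x.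
have m0 : 0 < m.
  by apply: lt_le_trans d0 _; apply: lb_le_inf => [|_ [x /= x1 <-]];
    [case: hE|exact: phid].
have [M M0 deltaM] := Re_oscillation_bounded s.
have [t [t0 t1 slope_t]] := near_min_slope m0 M0.
have [_ [x /= x1 <-]] := inf_adherent (mulr_gt0 t0 t0) hE; rewrite -/m => phix.
pose delta (f : dual V) y := complex.Re (f y) - complex.Re (f x).
have slope y : `|y| <= 1 -> - \sum_(f <- s) u f x * delta f y <= m / 2.
  move=> y1; pose w := (1 - t)%:C%C *: x + t%:C%C *: y.
  have w1 : `|w| <= 1.
    rewrite (le_trans (ler_normD _ _))// !normrZ.
    rewrite !ger0_norm ?ler0c ?subr_ge0 ?(ltW t0)//.
    have -> : 1 = (1 - t)%:C%C * 1 + t%:C%C * 1 :> R[i].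
      by rewrite !mulr1 -rmorphD subrK.
    by rewrite lerD// ler_wpM2l// ler0c ?subr_ge0// ltW.
  apply: slope_t phix (deltaM _ _ x1 y1) _; rewrite (le_trans (mle _ w1))//.
  rewrite le_eqVlt; apply/orP; left; apply/eqP.
  rewrite /phi !mulr_sumr -!big_split; apply: eq_bigr => f _ /=.
  rewrite /u /delta !raddfB.
  have -> : f w = (1 - t)%:C%C * f x + t%:C%C * f y.
    by rewrite linearD !linearZ.
  rewrite raddfD /= !Re_scale.
  by move: (complex.Re _) (complex.Re _) (complex.Re _) => a b c; clear; ring.
pose g := \sum_(f <- s) (- u f x)%:C%C *: f.
have Re_g (q : dual (dual V)) :
    complex.Re (q g) = - \sum_(f <- s) u f x * complex.Re (q f).
  rewrite linear_sum raddf_sum -sumrN; apply: eq_bigr => f _ /=.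
  by rewrite linearZ [LHS]Re_scale mulNr.
have Re_gx y : complex.Re (g y) = - \sum_(f <- s) u f x * complex.Re (f y).
  exact: (Re_g (canonical_embedding y)).
have gle : `|g| <= (complex.Re (g x) + m / 2)%:C%C.
  apply: norm_le_of_Re_le => y /slope; rewrite !Re_gx -lerBlDl opprK.
  apply: le_trans; rewrite addrC -sumrB -sumrN.
  by apply: ler_sum => f _; rewrite /delta mulrBr opprB.
have pg : complex.Re (p g) <= complex.Re (g x) + m / 2.
  apply: Re_le_norm; apply: le_trans gle.
  by rewrite (le_trans (le_blin_norm _ _))// ler_piMl.
have phi_g : phi x = complex.Re (p g) - complex.Re (g x).
  rewrite Re_g Re_gx opprK addrC -sumrB; apply: eq_bigr => f _.
  by rewrite -mulrBr -raddfB expr2.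
have := mle _ x1; rewrite phi_g leNgt => /negP; apply.
by rewrite ltrBlDl (le_lt_trans pg)// ltrD2l ltr_pdivrMr// mulr_natr mulr2n
  ltrDl.
Qed.

(** The imaginary part of [f x - p f] is controlled by the real part for the
functional ['i *: f], so the list of functionals is doubled. *)
Lemma goldstine V (p : dual (dual V)) (s : seq (dual V)) (e : R[i]) :
  `|p| <= 1 -> 0 < e ->
  exists2 x, `|x| <= 1 & forall f, f \in s -> `|f x - p f| < e.
Proof.
move=> p1 e0; have er : (complex.Re e)%:C%C = e by rewrite ReK// ltW.
have r0 : 0 < complex.Re e / 2 by rewrite divr_gt0// -ltcR er.
have [x x1 sumx] := Re_goldstine (s ++ [seq 'i%C *: f | f <- s]) p1
  (mulr_gt0 r0 r0).
exists x => // f fs.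
have small h : h \in s ++ [seq 'i%C *: f | f <- s] ->
    `|complex.Re (h x - p h)| < complex.Re e / 2.
  move=> hs; rewrite -(@ltr_pXn2r _ 2) ?nnegrE ?(ltW r0)//.
  rewrite real_normK ?num_real// expr2 [ltRHS]expr2; apply: le_lt_trans sumx.
  by rewrite (big_rem h hs)/= expr2 lerDl sumr_ge0// => g _; exact: sqr_ge0.
have fi : ('i%C *: f) x - p ('i%C *: f) = 'i%C * (f x - p f).
  by rewrite blinZE linearZ mulrBr.
rewrite (le_lt_trans (normC_le_ReIm _))// -er ltcR [ltRHS]splitr ltrD//.
  by apply: small; rewrite mem_cat fs.
have := small ('i%C *: f); rewrite fi mulrC ReiNIm normrN; apply.
by rewrite mem_cat map_f ?orbT.
Qed.

Lemma weak_eval_continuous W (r : dual W) (w : weak W) :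
  (r : weak W -> R[i]) v @[v --> w] --> r w.
Proof.
have := @initial_continuous _ _
  (fun v : W => (fun f : dual W => f v) : {ptws dual W -> R[i]}) w.
move=> c; exact: (cvg_comp _ _ c (@proj_continuous (dual W) (fun=> R[i]) r _)).
Qed.

(** Half of Gantmacher's theorem. By Goldstine's theorem [p] is a weak* limit of
vectors of the unit ball; a weak cluster point [w] of their images under [T]
exists by compactness, and represents [T^** p]. *)
Lemma weakly_compact_bidual V W (T : blin V W) (p : dual (dual V)) :
  weakly_compact T -> exists w, forall r : dual W, p (adjoint T r) = r w.
Proof.
move=> [K TK [Kc _]].
wlog p1 : p / `|p| <= 1 => [unit_case|].
  have c0 : 0 < `|p| + 1 by rewrite ltr_wpDl.
  have [|w pw] := unit_case ((`|p| + 1)^-1 *: p).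
    by rewrite normrZ normfV ger0_norm ?(ltW c0)// ler_pdivrMl// mulr1 lerDl.
  exists ((`|p| + 1) *: w) => r.
  by rewrite linearZ /= -pw blinZE /GRing.scale /= mulVKf// lt0r_neq0.
(* The filter [F] plays the role of the image under [T] of a net of the unit
   ball that converges to [p] in the weak* topology. *)
pose B (i : seq (dual W) * R) : set (weak W) := [set T x | x in
  [set x | `|x| <= 1 /\
    forall r, r \in i.1 -> `|r (T x) - p (adjoint T r)| < i.2%:C%C]].
pose F := filter_from [set i : seq (dual W) * R | 0 < i.2] B.
have FF : ProperFilter F.
  apply: filter_from_proper => [|[s e] /= e0].
    apply: filter_from_filter => [|[s e] [s' e'] /= e0 e'0].
      by exists ([::], 1) => /=.
    exists (s ++ s', Num.min e e'); first by rewrite /= lt_min e0.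
    move=> _ [x [x1 xs] <-]; split; exists x => //; split=> // r rs;
      (apply: lt_le_trans (xs r _) _; first by rewrite mem_cat rs ?orbT);
      by rewrite lecR ge_min lexx ?orbT.
  have eC : 0 < e%:C%C :> R[i] by rewrite ltcR.
  have [x x1 xs] := goldstine [seq adjoint T r | r <- s] p1 eC.
  exists (T x), x => //; split=> // r rs; apply: xs; exact: map_f.
have FK : F K.
  exists ([::], 1) => //= _ [x [x1 _] <-]; apply: TK; by exists x.
have [w [_ Fw]] := Kc F FF FK.
exists w => r; apply/eqP; rewrite eq_sym -subr_eq0 -normr_le0.
apply/ler_addgt0Pr => e e0; rewrite add0r.
have e2 : 0 < e / 2 by rewrite divr_gt0.
have e2r : (complex.Re (e / 2))%:C%C = e / 2 by rewrite ReK// ltW.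
have FB : F (B ([:: r], complex.Re (e / 2))).
  by exists ([:: r], complex.Re (e / 2)) => //=; rewrite -ltcR e2r.
have /cvgrPdist_lt/(_ _ e2) Nw := @weak_eval_continuous _ r w.
have [_ [[x [_ xr] <-] /= wx]] := Fw _ _ FB Nw.
have -> : r w - p (adjoint T r) =
  (r w - r (T x)) + (r (T x) - p (adjoint T r)) by rewrite addrA subrK.
rewrite (le_trans (ler_normD _ _))// [e]splitr lerD// ltW//.
by rewrite -e2r; apply: xr; rewrite /= mem_head.
Qed.

Lemma canonical_embedding_is_linear V : linear (@canonical_embedding R V).
Proof.
by move=> k x y; apply: blinP => f; rewrite blinDE blinZE /= linearP.
Qed.

Lemma norm_canonical_embedding V (x : V) : `|canonical_embedding x| <= 1 * `|x|.
Proof.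
by rewrite mul1r; apply: blin_norm_le => // f; exact: canonical_embedding_bound.
Qed.

Definition canonical_blin V : blin V (dual (dual V)) :=
  mkblin (@canonical_embedding_is_linear V) (@norm_canonical_embedding V).

End Goldstine.

(** * Arens products at weakly almost periodic functionals *)

Section BidualDerivation.
Variables (R : realType) (A : banachAlgebra R).
Implicit Types (a b : A) (f : dual A) (p q r : dual (dual A)).

Definition arens_agree f := forall p q, arens1 p q f = arens2 p q f.

Definition left_translates f : blin A (dual A) :=
  mkblin (actl_linearl f) (fun a => norm_actl a f).

(** If [g] in [A^*] represents the second adjoint of [a |-> a . f] at [q],
testing on the elements of [A] shows that [g] is [q . f]; testing on [p] is then
the claim. *)
Lemma WAP_arens_agree f : WAP A f -> arens_agree f.
Proof.
move=> wf p q.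
have [g qg] := @weakly_compact_bidual _ _ _ (left_translates f) q wf.
have gE : bactl q f = g.
  apply: blinP => b; rewrite -[RHS]/(canonical_embedding b g) -qg.
  rewrite -[LHS]/(q (actr f b)).
  by congr (q _); apply: blinP.
rewrite -[LHS]/(p (bactl q f)) gE -qg -[RHS]/(q (bactr f p)).
by congr (q _); apply: blinP.
Qed.

(** * Lifting cyclic derivations to the bidual, and restricting back *)

(** The identity is checked by peeling off the functionals one at a time: first
[p] on both sides, then [q] at a fixed [a], which leaves the derivation rule for
[D (ab)]. Agreement of the Arens products at [f], the value of the second
adjoint at [q], is what allows [p] to be peeled off the second term. Cyclicity
passes from [A] to the bidual in one variable at a time, which needs the value
at [p] to be in [A^*] so that [q] can be evaluated at it. *)
Lemma bidual_cyclic_derivation (D : blin A (dual A)) :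
  cyclic_derivation D ->
  (forall p, exists f, (forall r, p (adjoint D r) = r f) /\ arens_agree f) ->
  @cyclic_derivation _ (bidual_algebra A) (adjoint (adjoint D)).
Proof.
move=> [derD cycD] DA; split=> [p q|p q].
  apply: blinP => r; rewrite blinDE.
  rewrite -[LHS]/(p (bactl q (adjoint D r))).
  rewrite -[X in _ = X + _]/(p (adjoint D (arens1 q r))).
  rewrite -[X in _ = _ + X]/(q (adjoint D (arens1 r p))).
  have [f [qf agf]] := DA q.
  rewrite qf agf -[arens2 r p f]/(p (bactr f r)) -linearD; congr (p _).
  apply: blinP => a; rewrite blinDE.
  (* [ra] is the functional [h |-> r (a . h)]. *)
  pose ra : dual (dual A) := arens1 r (canonical_embedding a).
  have -> : bactr f r a = q (adjoint D ra).
    rewrite qf -[LHS]/(r (actl a f)).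
    rewrite -[RHS]/(r (bactl (canonical_embedding a) f)).
    by congr (r _); apply: blinP.
  rewrite -[LHS]/(q (actr (adjoint D r) a)).
  rewrite -[X in _ = X + _]/(q (bactl r (D a))) -linearD; congr (q _).
  apply: blinP => b; rewrite blinDE.
  rewrite -[LHS]/(r (D (ba_mul a b))) derD linearD; congr (_ + _).
  rewrite -[RHS]/(r (bactl (canonical_embedding a) (D b))); congr (r _).
  by apply: blinP.
rewrite -[X in X + _]/(p (adjoint D q)) -[X in _ + X]/(q (adjoint D p)).
have [f [pf _]] := DA p.
have -> : adjoint D p = - f.
  apply: blinP => b.
  rewrite blinNE -[f b]/(canonical_embedding b f) -pf -linearN.
  rewrite -[LHS]/(p (D b)); congr (p _); apply: blinP => a; rewrite blinNE.
  by apply/eqP; rewrite -addr_eq0; apply/eqP; exact: cycD.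
by rewrite pf linearN subrr.
Qed.

(** The adjoint of the canonical embedding is the restriction of functionals on
[A^**] to [A]. It is a contraction, it commutes with the actions of [A] because
the first Arens product extends the product of [A], and it maps the value of the
second adjoint at [a] to [D a]. *)
Lemma approximately_inner_restrict (D : blin A (dual A)) :
  @approximately_inner _ (bidual_algebra A) (adjoint (adjoint D)) ->
  approximately_inner D.
Proof.
move=> [I [le [x [dirI xD]]]].
have FF : Filter (tails le).
  apply: filter_from_filter => [|i j _ _].
    by case: (directed_inhabited dirI) => i; exists i.
  have [k [ik jk]] := directed_ub dirI i j; exists k => // l kl.
  by split; apply: (directed_trans dirI) kl.
exists I, le, (fun i => adjoint (canonical_blin A) (x i)); split=> // a.
pose restr := adjoint (canonical_blin A).
have restr_act (X : dual (bidual_algebra A)) :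
    actl a (restr X) - actr (restr X) a =
    restr (actl (canonical_embedding a : bidual_algebra A) X
           - actr X (canonical_embedding a : bidual_algebra A)).
  have embM b c : arens1 (canonical_embedding b) (canonical_embedding c) =
      canonical_embedding (ba_mul b c) by apply: blinP.
  apply: blinP => b; rewrite blinDE blinNE.
  rewrite -[RHS]/((actl _ X - actr X _) (canonical_embedding b)).
  rewrite blinDE blinNE; congr (_ - _).
    rewrite -[RHS]/(X (arens1 (canonical_embedding b) (canonical_embedding a))).
    by rewrite embM.
  rewrite -[RHS]/(X (arens1 (canonical_embedding a) (canonical_embedding b))).
  by rewrite embM.
have restr_norm (X : dual (bidual_algebra A)) : `|restr X| <= `|X|.
  apply: blin_norm_le => // b.
  rewrite -[restr X b]/(X (canonical_embedding b)).
  rewrite (le_trans (le_blin_norm _ _))// ler_wpM2l//.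
  by rewrite (le_trans (norm_canonical_embedding b))// mul1r.
have DE : D a = restr (adjoint (adjoint D) (canonical_embedding a)).
  by apply: blinP => b.
rewrite DE; under eq_fun do rewrite restr_act.
have /cvgrPdist_lt xDa := xD (canonical_embedding a).
apply/cvgrPdist_lt => e e0; apply: filterS (xDa e e0) => i; apply: le_lt_trans.
by rewrite -linearB; exact: restr_norm.
Qed.

End BidualDerivation.

Theorem theorem3p5 (R : realType) (A : banachAlgebra R) :
  (approximately_cyclic_amenable (bidual_algebra A) ->
   (forall D : blin A (dual A), cyclic_derivation D ->
      range (adjoint (adjoint D)) `<=`
      [set canonical_embedding f | f in WAP A]) ->
   approximately_cyclic_amenable A)
  /\
  (arens_regular A ->
   (forall D : blin A (dual A), derivation D -> weakly_compact D) ->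
   approximately_cyclic_amenable (bidual_algebra A) ->
   approximately_cyclic_amenable A).
Proof.
split=> [amen ranges D cycD|regA wcD amen D cycD];
    apply: approximately_inner_restrict; apply: amen;
    apply: bidual_cyclic_derivation => // p.
  have [f wf fE] := ranges D cycD _ (imageT (adjoint (adjoint D)) p).
  exists f; split; last exact: WAP_arens_agree.
  by move=> r; rewrite -[LHS]/(adjoint (adjoint D) p r) -fE.
have [f pf] := weakly_compact_bidual p (wcD D cycD.1).
by exists f; split=> // r q; rewrite regA.
Qed.
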